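(* Let $d \geq 3$. Suppose a backbend sequence $\tilde{\beta}$ converges from below to a $k$-cyclic backbend sequence $\beta$ for some $k \in \mathbb{N}$. Then, for all $l \in \mathbb{N}$ and all $e \in \{2, \ldots, d-1\}$, we have $p^{\tilde{\beta}}_c (\mathbb{Q}_l^e) = p^{\beta}_c (\mathbb{Q}_l^e)$.
   Context: Let $\mathbb{Z}_+ = \mathbb{N}\cup\{0\}$. The $d$-dimensional body-centered cubic (BCC) lattice is the graph $(\mathbb{V},\mathbb{E})$ with vertex set $\mathbb{V} = \{x \in \mathbb{Z}^d : x_i \equiv x_j \ (\mathrm{mod}\ 2) \text{ for all } i,j\}$ and edge set $\mathbb{E}$ consisting of all unordered pairs $\langle x,y\rangle$ of vertices with $|x_1-y_1| = \cdots = |x_d-y_d| = 1$. Each edge is independently open with probability $p \in [0,1]$ and closed with probability $1-p$; $\mathbb{P}_p$ is the corresponding product measure. For $\widehat{\mathbb{V}} \subseteq \mathbb{V}$, a path in $\widehat{\mathbb{V}}$ is a sequence $x^0,\ldots,x^n$ of distinct vertices of $\widehat{\mathbb{V}}$ with $\langle x^i,x^{i+1}\rangle \in \mathbb{E}$; it is open if all its edges are open. The record level of a path $\pi = (x^0,\ldots,x^n)$ till $x^i$ is $h^i(\pi) = \max_{j \leq i} x^j_d$. A backbend sequence is a map $\beta : \mathbb{Z}_+ \to \mathbb{Z}_+\cup\{\infty\}$, with $\beta_i := \beta(i)$. For $x \in \widehat{\mathbb{V}}$ with $x_d \geq 0$, a path $\pi = (x^0 = x,\ldots,x^n)$ in $\widehat{\mathbb{V}}$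 is a $\beta$-backbend path in $\widehat{\mathbb{V}}$ from $x$ to $x^n$ if $x^i_d \geq h^i(\pi) - \beta_{h^i(\pi)}$ for every $i$. Let $C^{\beta}_{\widehat{\mathbb{V}}}$ be the random set of $x \in \widehat{\mathbb{V}}$ such that there is an open $\beta$-backbend path in $\widehat{\mathbb{V}}$ from the origin $(0,\ldots,0)$ to $x$. Put $\theta^{\beta}_{\widehat{\mathbb{V}}}(p) = \mathbb{P}_p(|C^{\beta}_{\widehat{\mathbb{V}}}| = \infty)$ and $p^{\beta}_c(\widehat{\mathbb{V}}) = \sup\{p \in [0,1]: \theta^{\beta}_{\widehat{\mathbb{V}}}(p) = 0\}$. A backbend sequence $\beta$ is $k$-cyclic ($k\in\mathbb{N}$) if for all $i \in \{0,\ldots,k-1\}$, $\beta_{kn+i} = \beta_i \in \mathbb{Z}_+$ for all $n \in \mathbb{N}$. A backbend sequence $\tilde\beta$ converges from below to a $k$-cyclic backbend sequence $\beta$ if for all $i \in \{0,\ldots,k-1\}$, $\lim_{n\to\infty}\tilde\beta_{kn+i} = \beta_i$ and $\tilde\beta_{kn+i} \leq \beta_i$ for all $n \in \mathbb{Z}_+$. For $l \in \mathbb{N}$ and $e \in \{2,\ldots,d\}$, the $e$-dimensional half-slab is $\mathbb{Q}_l^e = \{x \in \mathbb{V} : x \in [-l,l]^{d-e}\times\mathbb{Z}^{e-1}\times\mathbb{Z}_+\}$. *)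

(* Defs.v *)
From mathcomp Require Import all_boot all_order all_algebra finmap.
From mathcomp Require Import all_classical all_reals all_analysis.

Set Implicit Arguments.
Unset Strict Implicit.
Unset Printing Implicit Defensive.

Import Order.TTheory GRing.Theory Num.Theory.
Import numFieldNormedType.Exports.

Local Open Scope classical_set_scope.
Local Open Scope ring_scope.

(* The dimension is d = n.+1, so that the last coordinate x_d always exists:
   it is the coordinate of index ord_max. *)

Section lattice.
Context {n : nat}.
Implicit Types x y : 'rV[int]_n.+1.

Definition height x : int := x ord0 ord_max.

Definition bcc_vertices : set 'rV[int]_n.+1 :=
  [set x : 'rV[int]_n.+1 | forall i j, (x ord0 i = x ord0 j %[mod 2])%Z].

Definition bcc_edges : set (set 'rV[int]_n.+1) :=
  [set [set z.1; z.2] | z in [set z : 'rV[int]_n.+1 * 'rV[int]_n.+1 |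
    [/\ bcc_vertices z.1, bcc_vertices z.2 &
        forall i, `|z.1 ord0 i - z.2 ord0 i| = 1]]].

(* [-l, l]^(d-e) x Z^(e-1) x Z_+, intersected with the lattice *)
Definition half_slab (l e : nat) : set 'rV[int]_n.+1 :=
  [set x : 'rV[int]_n.+1 | [/\ bcc_vertices x,
               forall i : 'I_n.+1, (i < n.+1 - e)%N -> `|x ord0 i| <= l%:Z &
               0 <= height x]].

End lattice.
Arguments bcc_edges n : clear implicits.
Arguments half_slab n l e : clear implicits.

Definition coordinate_events (n : nat) : set (set (bcc_edges n -> bool)) :=
  [set A | exists e, exists B : set bool, A = [set w | B (w e)]].

(* Configurations (true = open), with the product sigma-algebra. *)
Definition config (n : nat) := g_sigma_algebraType (@coordinate_events n).

(* P is the product over all edges of the Bernoulli(p) law on bool; this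
   determines P uniquely. *)
Definition is_bernoulli_product (R : realType) (n : nat) (p : R)
    (P : probability (config n) R) : Prop :=
  forall (F : {fset bcc_edges n}) (B : bcc_edges n -> set bool),
    P [set w : config n | forall e, e \in F -> B e (w e)] =
    (\prod_(e <- F) bernoulli_prob p (B e))%E.

(* Z_+ u {oo}, as a topological space: Some m is m and None is oo. *)
Notation natbar := (one_point_compactification nat).

Definition natbar_le (a b : natbar) : bool :=
  match a, b with
  | _, None => true
  | None, Some _ => false
  | Some u, Some v => (u <= v)%N
  end.

Definition backbend_sequence : Type := nat -> natbar.

Definition cyclic (k : nat) (beta : backbend_sequence) : Prop :=
  forall i, (i < k)%N ->
    beta i != None /\ forall m, beta (k * m + i)%N = beta i.

Definition converges_from_below (k : nat) (beta' beta : backbend_sequence) :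
    Prop :=
  forall i, (i < k)%N ->
    (beta' (k * m + i)%N @[m --> \oo] --> beta i) /\
    forall m, natbar_le (beta' (k * m + i)%N) (beta i).

Section backbend_percolation.
Context {n : nat}.
Implicit Types (x y : 'rV[int]_n.+1) (s : seq 'rV[int]_n.+1) (w : config n)
  (W : set 'rV[int]_n.+1) (beta : backbend_sequence).

(* Below, the path (x^0, ..., x^m) is given by x = x^0 and
   s = [:: x^1; ...; x^m]. *)
Definition is_path W x s : Prop :=
  [/\ {in x :: s, forall y, W y}, uniq (x :: s) &
      path (fun y z => [set y; z] \in bcc_edges n) x s].

Definition is_open w y z : bool :=
  `[< exists e : bcc_edges n, val e = [set y; z] /\ w e >].

Definition open_path w x s : Prop := path (is_open w) x s.

Definition record_level x s (i : nat) : int :=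
  \big[Num.max/height x]_(j < i.+1) height (nth x (x :: s) j).

(* The starting point has nonnegative height, so the record levels are
   nonnegative and absz merely casts them to nat. *)
Definition backbend_path beta W x s : Prop :=
  [/\ is_path W x s, 0 <= height x &
      forall i, (i <= size s)%N ->
        let h := record_level x s i in
        if beta `|h|%N is Some b then h - b%:Z <= height (nth x (x :: s) i)
        else true].

Definition backbend_cluster beta W w : set 'rV[int]_n.+1 :=
  [set y | exists s,
    [/\ backbend_path beta W 0 s, open_path w 0 s & last 0 s = y]].

Definition theta (R : realType) (P : probability (config n) R) beta W :
    \bar R :=
  P [set w : config n | infinite_set (backbend_cluster beta W w)].

(* P p is meant to be the percolation measure of parameter p. *)
Definition critical_probability (R : realType)
    (P : R -> probability (config n) R) beta W : R :=
  sup [set p : R | 0 <= p <= 1 /\ theta (P p) beta W = 0%E].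

End backbend_percolation.

(* Main.v *)
Require Import Defs.
From mathcomp Require Import all_boot all_order all_algebra finmap.
From mathcomp Require Import all_classical all_reals all_analysis.
From mathcomp Require Import zify.

Set Implicit Arguments.
Unset Strict Implicit.
Unset Printing Implicit Defensive.

Import Order.TTheory GRing.Theory Num.Theory.
Local Open Scope classical_set_scope.
Local Open Scope ring_scope.

(** Integers that converge to a finite limit are eventually equal to it, so
[beta'] coincides with the [k]-periodic sequence [beta] from some height on.
Choose an even multiple [N] of [k] above that height.  By periodicity,
[beta' (N + m) = beta m] for every [m]: a [beta]-backbend path from the origin,
translated upwards by [N], obeys the rule of [beta'].

To start such a translated path from the origin, climb along a fixed zigzag
that gains one level per step and ends at [(0, ..., 0, N)].  It never bends
back, so it obeys every backbend rule ([backbend_path_climb_then]).  It uses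
finitely many edges, each with an endpoint of height less than [N], whereas the
translated path only uses edges at height [N] or more.  By independence and
translation invariance ([bernoulli_product_reindex]),

  [p ^ (number of zigzag edges) * theta beta p <= theta beta' p]

([theta_ge_shift]).  Conversely [beta' <= beta] gives
[theta beta' p <= theta beta p] ([theta_mono]).  Hence the two percolation
probabilities vanish for the same [p > 0], and the two suprema agree, as
the point [0] does not matter for a supremum of nonnegative numbers
(the supremum of the empty set being [0]). *)

(** * Independence and relabelling of edges *)

Section product.
Context {R : realType} {n : nat}.
Implicit Types (p : R) (P : probability (config n) R).

Lemma measurable_coordinate (e : bcc_edges n) (B : set bool) :
  measurable [set w : config n | B (w e)].
Proof. by apply: sub_sigma_algebra; exists e, B. Qed.

Definition cylinder (F : {fset bcc_edges n}) (B : bcc_edges n -> set bool) :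
  set (config n) := [set w | forall e, e \in F -> B e (w e)].

Lemma measurable_cylinder F B : measurable (cylinder F B).
Proof.
rewrite (_ : cylinder F B =
  \bigcap_(e in [set` F]) [set w : config n | B e (w e)]); last first.
  by apply/seteqP; split => w h e; exact: h.
apply: fin_bigcap_measurable => [|e _]; first exact: finite_fset.
exact: measurable_coordinate.
Qed.

Definition reindex (phi : bcc_edges n -> bcc_edges n) (w : config n) :
  config n := w \o phi.

Lemma measurable_reindex phi : measurable_fun setT (reindex phi).
Proof.
apply: (@measurability _ _ (config n) (config n) _ _ (@coordinate_events n)).
  by [].
move=> _ [_ [e [B ->]] <-].
by rewrite setTI; exact: measurable_coordinate.
Qed.

Lemma cylinder_setI_closed :
  setI_closed [set A | exists F B, A = cylinder F B].
Proof.
move=> _ _ [F [B ->]] [G [C ->]].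
exists (F `|` G)%fset,
  (fun e => [set b | (e \in F -> B e b) /\ (e \in G -> C e b)]).
apply/seteqP; split => [w [hF hG] e _|w h].
  by split=> ?; [exact: hF|exact: hG].
by split=> e he; apply h => //; rewrite in_fsetU he ?orbT.
Qed.

(** Cylinders form a pi-system that generates the sigma-algebra, so a finite
measure on configurations is determined by its values on them. *)
Lemma cylinders_generate :
  (measurable : set (set (config n))) =
  <<s [set A | exists F B, A = cylinder F B] >>.
Proof.
apply/seteqP; split.
  apply: smallest_sub; first exact: smallest_sigma_algebra.
  move=> _ [e [B ->]]; apply: sub_sigma_algebra.
  exists [fset e]%fset, (fun=> B); apply/seteqP; split => [w h e'|w].
    by rewrite inE => /eqP ->.
  by apply; rewrite inE.
apply: smallest_sub; first exact: sigma_algebra_measurable.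
by move=> _ [F [B ->]]; exact: measurable_cylinder.
Qed.

Lemma bernoulli_prob_true p : 0 <= p <= 1 ->
  bernoulli_prob p [set true] = p%:E.
Proof.
move=> p01; rewrite bernoulli_probE// !diracE mem_set//= mule1.
by rewrite memNset ?mule0 ?adde0.
Qed.

(** The states of the edges [phi e] are again independent with parameter [p],
and independent of the states of the edges of [F].  Both sides are finite
measures in [A]; when [A] is a cylinder over [G], the left-hand side is the
probability of a cylinder over the disjoint union of [F] and [phi @` G]. *)
Lemma bernoulli_product_reindex p P (phi : bcc_edges n -> bcc_edges n)
    (F : {fset bcc_edges n}) (A : set (config n)) :
  0 <= p <= 1 -> is_bernoulli_product p P -> injective phi ->
  (forall e, phi e \notin F) -> measurable A ->
  P (cylinder F (fun=> [set true]) `&` reindex phi @^-1` A) =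
  ((p ^+ #|` F|)%:E * P A)%E.
Proof.
move=> p01 hP phi_inj phiF.
have /andP[p0 _] := p01.
pose mF := measurable_cylinder F (fun=> [set true]).
pose mphi := measurable_reindex phi.
pose m1 : {measure set (config n) -> \bar R} :=
  pushforward (mrestr P mF) (reindex phi).
have pF0 : 0 <= p ^+ #|` F| by exact: exprn_ge0.
pose m2 : {measure set (config n) -> \bar R} := mscale (NngNum pF0) P.
rewrite setIC => mA.
change (m1 mphi A = m2 A).
apply: (@measure_unique _ R _ _ (fun=> setT) cylinders_generate
  cylinder_setI_closed _ _ (m1 mphi) m2 _ _ A mA) => [_|||k].
- exists fset0, (fun=> setT); apply/seteqP; split => // w _ e; by rewrite inE.
- by apply/seteqP; split => // w _; exists 0%N.
- move=> _ [G [B ->]].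
  have phiGP e : reflect (exists2 g, g \in G & e = phi g)
      (e \in [fset phi g | g in G]%fset) by exact: imfsetP.
  (* The second clause transports [B] along the injection [phi] without naming
     an inverse of it. *)
  pose C e := [set b : bool | (e \in F -> b = true) /\
    forall g, g \in G -> phi g = e -> B g b].
  rewrite /m1 /m2 /= /mscale /= /pushforward /mrestr /=.
  rewrite (_ : _ `&` _ = cylinder (F `|` [fset phi g | g in G])%fset C).
    rewrite !hP.
    rewrite (perm_big (F ++ [seq phi g | g <- G])) /=; last first.
      apply: uniq_perm => [||e]; first exact: fset_uniq.
        rewrite cat_uniq (map_inj_uniq phi_inj) !fset_uniq andbT /=.
        by apply/hasPn => _ /mapP[g _ ->].
      rewrite in_fsetU mem_cat; congr (_ || _).
      by apply/phiGP/mapP.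
    rewrite big_cat big_map /=; congr (_ * _)%E.
      under eq_big_seq => e eF.
        rewrite (_ : C e = [set true]); first by rewrite bernoulli_prob_true//; over.
        apply/seteqP; split => b; first by case=> + _; exact.
        move=> ->; split=> // g _ phige.
        by move: (phiF g); rewrite phige eF.
      elim: (enum_fset F) => [|e s IH]; first by rewrite big_nil.
      by rewrite big_cons IH -EFinM -exprS.
    apply: eq_big_seq => g gG; congr bernoulli_prob; apply/seteqP; split => b.
      by move=> [_]; exact.
    by move=> Bb; split=> [|g' _ /phi_inj -> //]; rewrite (negbTE (phiF g)).
  apply/seteqP; split => w /=.
    move=> [hG hF] e _; split => [eF|g gG <-]; [exact: hF|exact: hG].
  move=> h; split => [g gG|e eF].
    have [] := h (phi g); last by move=> _; exact.
    by rewrite in_fsetU; apply/orP; right; apply/phiGP; exists g.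
  by have [|+ _] := h e; [rewrite in_fsetU eF|exact].
- rewrite /m1 /= /pushforward /mrestr preimage_setT setTI.
  by apply: le_lt_trans (probability_le1 _ _) _ => //; rewrite ltry.
Qed.

End product.

(** * Measurability of infinite clusters *)

Section measurability.
Context {n : nat}.

Lemma measurable_is_open (y z : 'rV[int]_n.+1) :
  measurable [set w : config n | is_open w y z].
Proof.
have [[e eyz]|noedge] := pselect (exists e : bcc_edges n, val e = [set y; z]).
  rewrite (_ : [set w | _] = [set w : config n | [set true] (w e)]).
    exact: measurable_coordinate.
  apply/seteqP; split => w /=.
    by move/asboolP => [e' [e'yz we']]; rewrite -(val_inj (etrans e'yz (esym eyz))).
  by move=> we; apply/asboolP; exists e; rewrite we.
rewrite (_ : [set w | _] = set0) //; apply/seteqP; split => // w /=.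
by move/asboolP => [e [eyz _]]; apply: noedge; exists e.
Qed.

Lemma measurable_open_path (x : 'rV[int]_n.+1) s :
  measurable [set w : config n | open_path w x s].
Proof.
elim: s x => [|y s IH] x.
  by rewrite (_ : [set w | _] = setT) //; apply/seteqP; split.
rewrite (_ : [set w | _] = [set w : config n | is_open w x y] `&`
                           [set w : config n | open_path w y s]).
  by apply: measurableI; [exact: measurable_is_open|exact: IH].
by apply/seteqP; split => w /= /andP.
Qed.

(** There are countably many paths, and [w] intervenes only through the finitely
many edges of each. *)
Lemma measurable_mem_cluster beta W (y : 'rV[int]_n.+1) :
  measurable [set w : config n | backbend_cluster beta W w y].
Proof.
pose G s : set (config n) := [set w | backbend_path beta W 0 s /\ last 0 s = y]
  `&` [set w | open_path w 0 s].
rewrite (_ : [set w | _] = \bigcup_s G s).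
  apply: countable_bigcupT_measurable; first exact: countableP.
  move=> s; rewrite /G.
  have [ok|bad] := pselect (backbend_path beta W 0 s /\ last 0 s = y).
    rewrite (_ : [set w | _ /\ _] = setT); last by apply/seteqP; split.
    by rewrite setTI; exact: measurable_open_path.
  rewrite (_ : [set w | _ /\ _] = set0); last by apply/seteqP; split.
  by rewrite set0I.
apply/seteqP; split => w /=.
  by move=> [s [? ? ?]]; exists s.
by move=> [s _ [[? ?] ?]]; exists s.
Qed.

(** A cluster is finite when, for one of the countably many finite sets [F] of
vertices, it has no vertex outside [F]. *)
Lemma measurable_infinite_cluster beta (W : set 'rV[int]_n.+1) :
  measurable [set w : config n | infinite_set (backbend_cluster beta W w)].
Proof.
rewrite -[X in measurable X]setCK; apply: measurableC.
rewrite (_ : ~` _ = \bigcup_(F : {fset 'rV[int]_n.+1})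
  ~` \bigcup_y [set w : config n | backbend_cluster beta W w y /\ y \notin F]).
  apply: countable_bigcupT_measurable; first exact: countableP.
  move=> F; apply: measurableC.
  apply: countable_bigcupT_measurable; first exact: countableP.
  move=> y; case: (boolP (y \in F)) => yF.
    by rewrite (_ : [set w | _] = set0) //; apply/seteqP; split => // w [].
  rewrite (_ : [set w | _] = [set w : config n | backbend_cluster beta W w y]).
    exact: measurable_mem_cluster.
  by apply/seteqP; split => w // [].
apply/seteqP; split => w /=.
  move/contrapT/finite_fsetP => [F CF]; exists F => // -[y _ [+ /negP yF]].
  by rewrite CF.
move=> [F _ CF] inf; apply: inf; apply: (finite_subfset F) => y Cy /=.
by apply: contrapT => /negP yF; apply: CF; exists y.
Qed.

End measurability.

(** * The zigzag and the vertical translation *)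

Section geometry.
Context {n : nat}.
Implicit Types (x y : 'rV[int]_n.+1) (w : config n).

Definition zigzag i : 'rV[int]_n.+1 :=
  \row_(j < n.+1) if j == ord_max then i%:Z else (odd i)%:Z.

(** Translations by an even height, under which the lattice is invariant; the
zigzag is back on the vertical axis at even heights. *)
Definition raise K x := x + zigzag K.*2.

Lemma zigzag0 : zigzag 0 = 0.
Proof. by apply/rowP => j; rewrite !mxE; case: ifP. Qed.

Lemma raise0 K : raise K 0 = zigzag K.*2.
Proof. exact: add0r. Qed.

Lemma raise_inj K : injective (raise K).
Proof. exact: addIr. Qed.

Lemma height_zigzag i : height (zigzag i) = i%:Z.
Proof. by rewrite /height mxE eqxx. Qed.

Lemma height_raise K x : height (raise K x) = K.*2%:Z + height x.
Proof. by rewrite /height mxE [zigzag _ _ _]mxE eqxx addrC. Qed.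

Lemma bcc_vertices_zigzag i : bcc_vertices (zigzag i).
Proof.
have zi j : (zigzag i ord0 j = i%:Z %[mod 2])%Z.
  rewrite mxE; case: ifP => // _.
  by rewrite !modz_nat !modn2 oddb.
by move=> j j'; rewrite !zi.
Qed.

Lemma bcc_vertices_raise K x : bcc_vertices x -> bcc_vertices (raise K x).
Proof.
move=> bx i j; rewrite !mxE -modzDm (bx i j).
have := bcc_vertices_zigzag K.*2 i j; rewrite !mxE => ->.
by rewrite modzDm.
Qed.

Lemma half_slab_zigzag l e i : (0 < l)%N -> (0 < e)%N ->
  half_slab n l e (zigzag i).
Proof.
move=> l0 e0; split; first exact: bcc_vertices_zigzag.
  move=> j; rewrite mxE; case: eqP => [-> /=|_ _]; first by lia.
  by case: odd => /=; lia.
by rewrite height_zigzag.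
Qed.

Lemma half_slab_raise l e K x : (0 < e)%N ->
  half_slab n l e x -> half_slab n l e (raise K x).
Proof.
move=> e0 [bx xl hx]; split; first exact: bcc_vertices_raise.
  move=> j jne; rewrite mxE [zigzag _ _ _]mxE; case: eqP => [j_max|_].
    by move: jne; rewrite j_max /=; lia.
  by rewrite odd_double addr0; exact: xl.
by rewrite height_raise addr_ge0.
Qed.

Lemma bcc_edges_zigzag i :
  bcc_edges n [set zigzag i; zigzag i.+1].
Proof.
exists (zigzag i, zigzag i.+1) => //; split; try exact: bcc_vertices_zigzag.
by move=> j; rewrite !mxE; case: ifP => _ /=; [lia|case: odd].
Qed.

Lemma bcc_edges_raise K E : bcc_edges n E -> bcc_edges n (raise K @` E).
Proof.
move=> [[y z] /= [by_ bz yz1] <-]; exists (raise K y, raise K z) => /=.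
  split; [exact: bcc_vertices_raise|exact: bcc_vertices_raise|move=> i].
  rewrite -(yz1 i) [raise K y _ _]mxE [raise K z _ _]mxE.
  by rewrite opprD addrACA subrr addr0.
by rewrite image_setU !image_set1.
Qed.

Definition zigzag_edge i : bcc_edges n := SigSub (mem_set (bcc_edges_zigzag i)).

Definition zigzag_edges K : {fset bcc_edges n} :=
  [fset zigzag_edge i | i in iota 0 K.*2]%fset.

Definition upper (e : bcc_edges n) := forall x, val e x -> 0 <= height x.

(** Translating all the edges would hit the zigzag, so only those of the upper
half-space are moved; they land at height [K.*2] or more, while every zigzag
edge has an endpoint of smaller height.  An edge left in place has an endpoint
of negative height, so it is neither a zigzag edge nor the translate of an
upper one, and the map is injective. *)
Definition raise_edge K (e : bcc_edges n) : bcc_edges n :=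
  if `[< upper e >] then
    SigSub (mem_set (bcc_edges_raise K (set_valP e)))
  else e.

Lemma val_raise_edge K (e : bcc_edges n) :
  upper e -> val (raise_edge K e) = raise K @` val e.
Proof. by rewrite /raise_edge => /asboolP ->. Qed.

Lemma height_ge_raise_edge K (e : bcc_edges n) x :
  upper e -> val (raise_edge K e) x -> K.*2%:Z <= height x.
Proof.
move=> ue; rewrite val_raise_edge// => -[y ey <-].
by rewrite height_raise lerDl; exact: ue.
Qed.

Lemma upper_raise_edge K (e : bcc_edges n) : upper (raise_edge K e) <-> upper e.
Proof.
split => [|ue x ex].
  by rewrite {1}/raise_edge; case: asboolP.
by apply: le_trans (height_ge_raise_edge ue ex).
Qed.

Lemma raise_edge_inj K : injective (raise_edge K).
Proof.
move=> e e' ee'.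
have [ue|nue] := pselect (upper e).
  have ue' : upper e' by apply/(upper_raise_edge K); rewrite -ee'; exact/upper_raise_edge.
  apply: val_inj; move/(congr1 val): ee'; rewrite !val_raise_edge//.
  move=> im; apply/funext => x.
  by rewrite -(image_inj (@raise_inj K)) im (image_inj (@raise_inj K)).
have nue' : ~ upper e'.
  by move=> /(upper_raise_edge K); rewrite -ee' => /upper_raise_edge.
by move: ee'; rewrite /raise_edge !asboolF.
Qed.

Lemma raise_edge_notin_zigzag K (e : bcc_edges n) :
  raise_edge K e \notin zigzag_edges K.
Proof.
apply/negP => /imfsetP[i /=]; rewrite mem_iota /= add0n => iK ezi.
have : upper (raise_edge K e).
  by rewrite ezi => x /= [] ->; rewrite height_zigzag.
move/upper_raise_edge => ue.
have : K.*2%:Z <= height (zigzag i).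
  by apply: (height_ge_raise_edge ue); rewrite ezi /=; left.
by rewrite height_zigzag lez_nat leqNgt iK.
Qed.

End geometry.

(** * Climbing before following a path *)

Section concatenation.
Context {n : nat}.
Implicit Types (x y : 'rV[int]_n.+1) (w : config n).

Lemma record_level_le x s i m :
  record_level x s i <= m <->
  forall j, (j <= i)%N -> height (nth x (x :: s) j) <= m.
Proof.
split => [/bigmax_leP[_ h] j ji|h].
  exact: (h (Ordinal (ji : j < i.+1)%N)).
apply/bigmax_leP; split; first exact: (h 0%N).
by move=> j _; apply: h; rewrite -ltnS.
Qed.

Lemma record_level_ge0 x s i : 0 <= height x -> 0 <= record_level x s i.
Proof.
move=> x0; have /record_level_le h := lexx (record_level x s i).
exact: le_trans (h 0%N isT).
Qed.

Definition climb K : seq 'rV[int]_n.+1 := mkseq (fun i => zigzag i.+1) K.*2.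

Definition climb_then K (s : seq 'rV[int]_n.+1) := climb K ++ map (raise K) s.

(** The climb and the translated path share the vertex [raise K 0]; counting it
with the latter makes the indices below [K.*2] those of the zigzag. *)
Lemma climb_rcons K : 0 :: climb K = rcons (mkseq zigzag K.*2) (raise K 0).
Proof.
by rewrite raise0 -mkseqS /mkseq /= zigzag0 (iotaDl 1 0) -map_comp.
Qed.

Lemma climb_thenE K s :
  0 :: climb_then K s = mkseq zigzag K.*2 ++ map (raise K) (0 :: s).
Proof. by rewrite /climb_then -cat_cons climb_rcons cat_rcons. Qed.

Lemma size_climb_then K s : size (climb_then K s) = (K.*2 + size s)%N.
Proof. by rewrite size_cat size_mkseq size_map. Qed.

Lemma nth_climb_low K s i : (i < K.*2)%N ->
  nth 0 (0 :: climb_then K s) i = zigzag i.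
Proof. by move=> iK; rewrite climb_thenE nth_cat size_mkseq iK nth_mkseq. Qed.

Lemma nth_climb_high K s i : (i <= size s)%N ->
  nth 0 (0 :: climb_then K s) (K.*2 + i) = raise K (nth 0 (0 :: s) i).
Proof.
move=> si; rewrite climb_thenE nth_cat size_mkseq ltnNge leq_addr /= addKn.
by rewrite -[_ :: _]/(map (raise K) (0 :: s)) (nth_map 0).
Qed.

Lemma record_level_climb_low K s i : (i < K.*2)%N ->
  record_level 0 (climb_then K s) i = i%:Z.
Proof.
move=> iK; apply/le_anti/andP; split.
  apply/record_level_le => j ji.
  by rewrite nth_climb_low ?height_zigzag ?lez_nat//; exact: leq_ltn_trans iK.
rewrite -[leLHS](height_zigzag (n := n)) -(@nth_climb_low K s)//.
by have /record_level_le := lexx (record_level 0 (climb_then K s) i); apply.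
Qed.

Lemma record_level_climb_high K s i : (i <= size s)%N ->
  record_level 0 (climb_then K s) (K.*2 + i) = K.*2%:Z + record_level 0 s i.
Proof.
move=> si; have /record_level_le le_s := lexx (record_level 0 s i).
have /record_level_le le_cs :=
  lexx (record_level 0 (climb_then K s) (K.*2 + i)).
apply/le_anti/andP; split.
  apply/record_level_le => j ji; have [jK|Kj] := ltnP j K.*2.
    rewrite nth_climb_low// height_zigzag (@le_trans _ _ K.*2%:Z)//.
      by rewrite lez_nat ltnW.
    by rewrite lerDl; apply: le_trans (le_s 0%N isT); rewrite /height mxE.
  rewrite -(subnKC Kj) nth_climb_high; last by lia.
  by rewrite height_raise lerD2l; apply: le_s; lia.
rewrite -lerBrDl; apply/record_level_le => j ji.
rewrite lerBrDl -height_raise -nth_climb_high; last exact: leq_trans si.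
by apply: le_cs; rewrite leq_add2l.
Qed.

Lemma last_climb_then K s : last 0 (climb_then K s) = raise K (last 0 s).
Proof.
have -> : last 0 (climb_then K s) = last 0 (0 :: climb_then K s) by [].
by rewrite climb_thenE last_cat /= last_map.
Qed.

Lemma path_climb_then K s (r : rel 'rV[int]_n.+1) :
  (forall i, (i < K.*2)%N -> r (zigzag i) (zigzag i.+1)) ->
  path r 0 (climb_then K s) = path (relpre (raise K) r) 0 s.
Proof.
move=> rz; rewrite cat_path.
have -> : last 0 (climb K) = raise K 0.
  by rewrite -[last 0 (climb K)]/(last 0 (0 :: climb K)) climb_rcons last_rcons.
rewrite path_map andb_idl// => _; apply/(pathP 0) => i.
rewrite size_mkseq => iK; rewrite nth_mkseq//.
have -> : nth 0 (0 :: climb K) i = zigzag i; last exact: rz.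
by rewrite climb_rcons nth_rcons size_mkseq iK nth_mkseq.
Qed.

(** The climb and the translated path are disjoint, as the former stays below
height [K.*2] until its last vertex, where the latter starts. *)
Lemma is_path_climb_then l e K s : (0 < l)%N -> (0 < e)%N ->
  is_path (half_slab n l e) 0 s ->
  is_path (half_slab n l e) 0 (climb_then K s).
Proof.
move=> l0 e0 [sW s_uniq s_path]; split.
- move=> y; rewrite climb_thenE mem_cat => /orP[/mapP[i _ ->]|/mapP[z zs ->]].
    exact: half_slab_zigzag.
  by apply: half_slab_raise => //; exact: sW.
- rewrite climb_thenE cat_uniq mkseq_uniq; last first.
    by move=> i j /(congr1 height); rewrite !height_zigzag => -[].
  rewrite (map_inj_uniq (@raise_inj _ K)) s_uniq andbT andTb.
  apply/hasPn => _ /mapP[z zs ->]; apply/negP => /mapP[i].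
  rewrite mem_iota => iK /(congr1 height); rewrite height_raise height_zigzag.
  by have [_ _] := sW z zs; lia.
- rewrite path_climb_then.
    apply: sub_path s_path => y z /= /[!inE] /(bcc_edges_raise K).
    by rewrite image_setU !image_set1.
  by move=> i _; rewrite inE; exact: bcc_edges_zigzag.
Qed.

(** During the climb every vertex is at the record level.  Afterwards heights
and record levels are those of the original path increased by [K.*2], so the
allowance [beta' (K.*2 + h)] that applies is the original one, [beta h]. *)
Lemma backbend_path_climb_then beta' beta l e K s :
  (0 < l)%N -> (0 < e)%N -> (forall m, beta' (K.*2 + m)%N = beta m) ->
  backbend_path beta (half_slab n l e) 0 s ->
  backbend_path beta' (half_slab n l e) 0 (climb_then K s).
Proof.
move=> l0 e0 tail [s_path h0 s_bb]; split=> //; first exact: is_path_climb_then.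
move=> i; rewrite size_climb_then => si; have [iK|Ki] := ltnP i K.*2.
  rewrite record_level_climb_low// nth_climb_low// height_zigzag /=.
  by case: (beta' i) => // b; rewrite gerBl.
rewrite -(subnKC Ki); set j := (i - K.*2)%N.
have js : (j <= size s)%N by rewrite leq_subLR.
rewrite record_level_climb_high// nth_climb_high// height_raise /=.
have := s_bb j js; have := record_level_ge0 s j h0.
case: (record_level 0 s j) => // m _ /=.
rewrite -PoszD /= tail; case: (beta m) => // b.
by rewrite PoszD -addrA lerD2l.
Qed.

(** The states of the upper edges in [reindex (raise_edge K) w] are those of
their translates in [w]; paths in the half-slab see no other edges. *)
Lemma raise_mem_cluster beta' beta l e K w y :
  (0 < l)%N -> (0 < e)%N -> (forall m, beta' (K.*2 + m)%N = beta m) ->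
  cylinder (zigzag_edges K) (fun=> [set true]) w ->
  backbend_cluster beta (half_slab n l e) (reindex (raise_edge K) w) y ->
  backbend_cluster beta' (half_slab n l e) w (raise K y).
Proof.
move=> l0 e0 tail w_open [s [s_bb s_open <-]]; exists (climb_then K s).
split; [exact: backbend_path_climb_then tail s_bb| |exact: last_climb_then].
rewrite /open_path path_climb_then.
  have [[sW _ _] _ _] := s_bb.
  apply: (sub_in_path (P := mem (0 :: s)) _ _ s_open); last exact/allP.
  move=> y' z ys zs /asboolP[E [Eyz wE]]; apply/asboolP.
  exists (raise_edge K E); split; last exact: wE.
  rewrite val_raise_edge ?Eyz ?image_setU ?image_set1//.
  by move=> u; rewrite Eyz => -[->|->]; [have [] := sW _ ys|have [] := sW _ zs].
move=> i iK; apply/asboolP; exists (zigzag_edge i); split=> //.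
by apply: w_open; apply/imfsetP; exists i => //=; rewrite mem_iota.
Qed.

End concatenation.

(** * Comparison of percolation probabilities *)

Section comparison.
Context {R : realType} {n : nat}.
Implicit Types (P : probability (config n) R) (beta : backbend_sequence).

Lemma backbend_path_mono beta' beta (W : set 'rV[int]_n.+1) x s :
  (forall m, natbar_le (beta' m) (beta m)) ->
  backbend_path beta' W x s -> backbend_path beta W x s.
Proof.
move=> le_beta [s_path x0 s_bb]; split=> // i si /=.
move: (s_bb i si) (le_beta `|record_level x s i|%N) => /=.
case: (beta _) => // b; case: (beta' _) => // b' h bb' /=.
by apply: le_trans h; rewrite lerD2l lerN2 lez_nat.
Qed.

Lemma theta_mono P beta' beta (W : set 'rV[int]_n.+1) :
  (forall m, natbar_le (beta' m) (beta m)) ->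
  (theta P beta' W <= theta P beta W)%E.
Proof.
move=> le_beta; apply: le_measure; rewrite ?inE;
  [exact: measurable_infinite_cluster..|].
move=> w; apply: contra_not => fin; apply: sub_finite_set fin => y [s [bb ? ?]].
by exists s; split=> //; exact: backbend_path_mono bb.
Qed.

(** If the zigzag is open and the cluster is infinite in the translated
configuration, then the [beta']-cluster of the origin contains a translate of
that infinite cluster. *)
Lemma theta_ge_shift (p : R) P beta' beta l e K :
  0 <= p <= 1 -> is_bernoulli_product p P -> (0 < l)%N -> (0 < e)%N ->
  (forall m, beta' (K.*2 + m)%N = beta m) ->
  ((p ^+ #|` @zigzag_edges n K|)%:E * theta P beta (half_slab n l e) <=
   theta P beta' (half_slab n l e))%E.
Proof.
move=> p01 hP l0 e0 tail.
have mI b W := @measurable_infinite_cluster n b W.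
rewrite -(bernoulli_product_reindex (phi := raise_edge K) (F := zigzag_edges K) p01 hP)//.
- apply: le_measure; rewrite ?inE//.
    apply: measurableI; first exact: measurable_cylinder.
    by rewrite -[X in measurable X]setTI; exact: measurable_reindex.
  move=> w [w_open w_inf] fin; apply: w_inf.
  apply: (@sub_finite_set _ _
    (raise K @^-1` backbend_cluster beta' (half_slab n l e) w)).
    by move=> y; exact: raise_mem_cluster.
  by apply: finite_preimage fin => y z _ _; exact: raise_inj.
- exact: raise_edge_inj.
- exact: raise_edge_notin_zigzag.
Qed.

End comparison.

(** * The two backbend sequences *)

Lemma natbar_cvg_eventually (u : nat -> natbar) (b : nat) :
  u m @[m --> \oo] --> (Some b : natbar) ->
  exists M, forall m, (M <= m)%N -> u m = Some b.
Proof.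
move=> ucvg.
have /ucvg [M _ uM] : nbhs (Some b : natbar) [set Some b].
  have := one_point_compactification_some_nbhs _ _ (discrete_set1 b).
  by rewrite image_set1.
by exists M => m Mm; exact: uM.
Qed.

(** A [k]-cyclic sequence takes finite values, so along each of the finitely
many residues the limit is attained after finitely many terms. *)
Lemma converges_from_below_eventually k beta' beta : (0 < k)%N ->
  cyclic k beta -> converges_from_below k beta' beta ->
  exists M, forall m, (k * M <= m)%N -> beta' m = beta m.
Proof.
move=> k0 cyc cvg.
have /choice [M hM] (i : 'I_k) : exists M, forall m, (M <= m)%N ->
    beta' (k * m + i)%N = beta i.
  have [bi _] := cyc i (ltn_ord i); have [+ _] := cvg i (ltn_ord i).
  by case: (beta i) bi => // b _ /natbar_cvg_eventually.
exists (\max_i M i) => m km.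
rewrite (divn_eq m k) mulnC.
have [_ ->] := cyc (m %% k)%N (ltn_pmod m k0).
apply: (hM (Ordinal (ltn_pmod m k0))).
apply: leq_trans (leq_bigmax _) _.
by rewrite leq_divRL// mulnC.
Qed.

Lemma cyclic_period k beta : (0 < k)%N -> cyclic k beta ->
  forall q m, beta (k * q + m)%N = beta m.
Proof.
move=> k0 cyc q m; have [_ h] := cyc (m %% k)%N (ltn_pmod m k0).
rewrite [in LHS](divn_eq m k) (mulnC _ k) addnA -mulnDr h.
by rewrite [in RHS](divn_eq m k) (mulnC _ k) h.
Qed.

Lemma converges_from_below_le k beta' beta : (0 < k)%N -> cyclic k beta ->
  converges_from_below k beta' beta -> forall m, natbar_le (beta' m) (beta m).
Proof.
move=> k0 cyc cvg m; rewrite (divn_eq m k) mulnC.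
have [_ ->] := cyc (m %% k)%N (ltn_pmod m k0).
by have [_] := cvg (m %% k)%N (ltn_pmod m k0); apply.
Qed.

(** * Equality of critical probabilities *)

(* The dimension is d = n.+1, so e <= d - 1 reads e <= n. *)
Theorem corollary3p2 (R : realType) (n : nat) (hd : (3 <= n.+1)%N)
    (P : R -> probability (config n) R)
    (hP : forall p : R, 0 <= p <= 1 -> is_bernoulli_product p (P p))
    (k : nat) (hk : (0 < k)%N) (beta' beta : backbend_sequence)
    (hbeta : cyclic k beta) (hbeta' : converges_from_below k beta' beta)
    (l : nat) (hl : (0 < l)%N) (e : nat) (he : (2 <= e <= n)%N) :
  critical_probability P beta' (half_slab n l e) =
  critical_probability P beta (half_slab n l e).
Proof.
have le_beta := converges_from_below_le hk hbeta hbeta'.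
have [M agree] := converges_from_below_eventually hk hbeta hbeta'.
(* The factor 2 makes the translation preserve the parity condition of the
   lattice. *)
have tail m : beta' ((k * M).*2 + m)%N = beta m.
  rewrite agree -addnn; last by lia.
  by rewrite -mulnDr (cyclic_period hk hbeta).
have e0 : (0 < e)%N by lia.
rewrite /critical_probability.
set S' := [set p | _ /\ theta _ beta' _ = _].
set S := [set p | _ /\ theta _ beta _ = _].
have SS' : S `<=` S'.
  move=> p [p01 th0]; split=> //; apply/le_anti/andP; split.
    by rewrite -th0; exact: theta_mono.
  exact: measure_ge0.
have S'S p : S' p -> 0 < p -> S p.
  move=> [p01 th0] p0; split=> //.
  have := theta_ge_shift p01 (hP p p01) hl e0 tail.
  rewrite th0 => pth; apply/le_anti/andP; split; last exact: measure_ge0.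
  by move: pth; rewrite pmule_rle0// lte_fin exprn_gt0.
have S'01 p : S' p -> 0 <= p <= 1 by case.
have S_ub : has_ubound S by exists 1 => p /SS' /S'01 /andP[].
have S'_ub : has_ubound S' by exists 1 => p /S'01 /andP[].
have supS0 : 0 <= sup S.
  have [->|/set0P[p Sp]] := eqVneq S set0; first by rewrite sup0.
  by apply: le_trans (ub_le_sup S_ub Sp); have /andP[] := S'01 p (SS' p Sp).
have [S'0|/set0P S'n0] := eqVneq S' set0.
  suff -> : S = set0 by rewrite S'0.
  by apply/seteqP; split=> // p /SS'; rewrite S'0.
apply/le_anti/andP; split.
  apply: ge_sup => // p S'p; have [p0|p0] := ltP 0 p.
    by apply: (ub_le_sup S_ub); exact: S'S.
  exact: le_trans supS0.
have [->|/set0P Sn0] := eqVneq S set0.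
  have [p S'p] := S'n0; rewrite sup0; apply: le_trans (ub_le_sup S'_ub S'p).
  by have /andP[] := S'01 p S'p.
by apply: ge_sup => // p Sp; apply: (ub_le_sup S'_ub); exact: SS'.
Qed.
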